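(* Let $X$ be a locally compact subset of $\mathbb R^d$, $d\geq 1$ (i.e., $X$ is the intersection of an open subset and a closed subset of $\mathbb R^d$). Let $E$ be a lattice subspace of $F(X)$ containing $\{\mathbf 1,pr_1,\dots,pr_d,\sum_{i=1}^d pr_i^2\}$ and let $(L_n)_{n\geq 1}$ be a sequence of positive linear operators from $E$ into $F(X)$ such that for every $g\in\{\mathbf 1,pr_1,\dots,pr_d,\sum_{i=1}^d pr_i^2\}$ $$\lim_{n\to\infty}L_n(g)=g\quad\text{uniformly on compact subsets of } X.$$ Then, for every $f\in E\cap C_b(X)$, $\lim_{n\to\infty}L_n(f)=f$ uniformly on compact subsets of $X$.
   Context: $F(X)$ is the linear space of all real-valued functions on $X$. A linear subspace $E$ of $F(X)$ is a lattice subspace if $|f|\in E$ for every $f\in E$. $C_b(X)$ is the space of all continuous bounded real-valued functions on $X$. $\mathbf 1$ is the constant function with value $1$; $pr_j$ is the (restriction to $X$ of the) $j$-th coordinate function $pr_j(x)=x_j$ on $\mathbb R^d$. A linear operator $L:E\to F(X)$ is positive if $L(f)\geq 0$ for every $f\in E$ with $f\geq 0$ (pointwise order). *)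

(* Defs.v *)
From HB Require Import structures.
From mathcomp Require Import all_boot all_order all_algebra.
From mathcomp Require Import all_classical all_reals all_analysis.

Set Implicit Arguments.
Unset Strict Implicit.
Unset Printing Implicit Defensive.

Import Order.TTheory GRing.Theory Num.Theory.
Import numFieldNormedType.Exports.

Local Open Scope classical_set_scope.
Local Open Scope ring_scope.

(* [submodClosed] predicates have no attached type: this makes one into an
   [lmodType], so that operators on it are [{linear submod_type E -> _}]. *)
Section SubmodType.
Variables (R : pzRingType) (V : lmodType R) (E : submodClosed V).

Record submod_type := Submod { submod_val : V; _ : submod_val \in E }.

HB.instance Definition _ := [isSub for submod_val].
HB.instance Definition _ := [Choice of submod_type by <:].
HB.instance Definition _ := [SubChoice_isSubLmodule of submod_type by <:].

End SubmodType.

Section LatticeSubspaces.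
Variables (R : realType) (d : nat).

(* The topology of ['rV[R]_d] is the usual topology of R^d, and a set
   [X : set 'rV[R]_d], used as a type, carries the topology induced by it. *)

(* For subsets of R^d, local compactness of the induced topology amounts to
   being the intersection of an open set and a closed set. *)
Definition locally_compact_subset (X : set 'rV[R]_d) : Prop :=
  exists U C : set 'rV[R]_d, [/\ open U, closed C & X = U `&` C].

Variable X : set 'rV[R]_d.

Definition pr (j : 'I_d) : X -> R := fun x => (\val x : 'rV[R]_d) ord0 j.

Definition sum_pr_sq : X -> R := fun x => \sum_(i < d) pr i x ^+ 2.

Definition test_functions : set (X -> R) :=
  [set cst 1] `|` range pr `|` [set sum_pr_sq].

Definition lattice_subspace (E : submodClosed (X -> R)) : Prop :=
  forall f : X -> R, f \in E -> (fun x => `|f x|) \in E.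

Definition Cb : set (X -> R) := [set f | continuous f /\ bounded_fun f].

Definition positive_operator (E : submodClosed (X -> R))
    (L : submod_type E -> (X -> R)) : Prop :=
  forall f : submod_type E,
    (forall x : X, 0 <= \val f x) -> forall x : X, 0 <= L f x.

End LatticeSubspaces.

Arguments pr {R d} X j _.
Arguments sum_pr_sq {R d} X _.
Arguments test_functions {R d} X _.
Arguments Cb {R d} X _.

(* Main.v *)
(** On a compact K, continuity and boundedness of f give, for each e > 0, a constant
    C with |f y - f x| <= e + C |y - x|^2 for all x in K and all y in X.  The right-hand
    side is, as a function of y, a combination of the test functions; applying the
    positive operator L_n and evaluating at y = x gives
    |L_n f x - f x L_n 1 x| <= e L_n 1 x + C L_n (|. - x|^2) x, and the last term tends
    to 0 uniformly on K because the coordinates of x are bounded there. *)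
Require Import Defs.
From HB Require Import structures.
From mathcomp Require Import all_boot all_order all_algebra.
From mathcomp Require Import all_classical all_reals all_analysis.
From mathcomp Require Import ring lra.
Import Order.TTheory GRing.Theory Num.Theory.
Import numFieldNormedType.Exports.
Local Open Scope classical_set_scope.
Local Open Scope ring_scope.

Lemma uniform_cvgrPdist_lt (R : realType) (U : choiceType) (I : Type)
    (F : set_system I) (FF : Filter F) (A : set U) (h : I -> U -> R) (f : U -> R) :
  {uniform A, h @ F --> f} <->
  forall e, 0 < e -> \forall i \near F, forall x, A x -> `|f x - h i x| < e.
Proof.
split=> [hf e e0|hf P /uniform_nbhs [B [/= entB subP]]].
  apply: (hf [set g | forall x, A x -> `|f x - g x| < e]).
  apply/uniform_nbhs; exists [set xy | ball xy.1 e xy.2]; split => //.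
  by rewrite -entourage_from_ballE; exists e.
have [e /= e0 eB] : exists2 e : R, 0 < e & forall xy, ball xy.1 e xy.2 -> B xy.
  by move: entB; rewrite -entourage_from_ballE => -[e /= e0 eB]; exists e.
apply: filterS (hf e e0) => i hi.
by apply: subP => y Ay; apply: eB; exact: hi.
Qed.

(** The Euclidean square, not the square of the library's max norm: only the former is, in [y], a
    linear combination of the test functions. *)
Definition sqdist {R : realType} {d : nat} {X : set 'rV[R]_d} (x y : X) : R :=
  \sum_(i < d) (pr X i y - pr X i x) ^+ 2.

Lemma sqdist_ge0 (R : realType) (d : nat) (X : set 'rV[R]_d) (x y : X) :
  0 <= sqdist x y.
Proof. by apply: sumr_ge0 => i _; exact: sqr_ge0. Qed.

(** The max norm is attained at some coordinate, whose square is one of the nonnegative summands. *)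
Lemma sqr_norm_le_sqdist (R : realType) (d : nat) (X : set 'rV[R]_d) (x y : X) :
  `|\val y - \val x : 'rV[R]_d| ^+ 2 <= sqdist x y.
Proof.
have [->|/mx_norm_neq0[[k i] /=]] := eqVneq `|\val y - \val x : 'rV[R]_d| 0.
  by rewrite expr0n sqdist_ge0.
rewrite ord1 !mxE => nE; rewrite [X in X ^+ 2]nE real_normK ?num_real//.
rewrite /sqdist (bigD1 i)//= lerDl.
by apply: sumr_ge0 => j _; exact: sqr_ge0.
Qed.

(** For [y] near [x], continuity gives the bound [e]; for [y] far from [x], the quadratic term
    exceeds twice a bound of [f] once [C] is large. The near-covering form of compactness turns the
    local thresholds for [C] into one valid on [K]. *)
Lemma quadratic_modulus (R : realType) (d : nat) (X : set 'rV[R]_d)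
    (K : set X) (f : X -> R) (e : R) :
  compact K -> Cb X f -> 0 < e ->
  \forall C \near +oo, forall x, K x -> forall y,
    `|f y - f x| <= e + C * sqdist x y.
Proof.
move=> /compact_near_coveringP cK [cf [M [_ fM]]] e0.
pose B := `|M| + 1.
have fB x : `|f x| <= B.
  by apply: fM => //; rewrite /B; have := ler_norm M; lra.
apply: (cK _ _ (fun C x => forall y, `|f y - f x| <= e + C * sqdist x y)).
move=> x0 Kx0.
have /cvgrPdist_lt /(_ (e / 2)) := cf x0.
rewrite divr_gt0// => /(_ isT) /nbhs_ballP [r /= r0 rf].
(* With [x] within [r / 2] of [x0], any [y] outside the [r]-ball of [x0] is at least [r / 2] from
   [x]; the threshold makes [C * (r / 2) ^+ 2] at least [B *+ 2]. *)
exists (ball x0 (r / 2), [set C | B *+ 2 / (r / 2) ^+ 2 <= C]) => /=.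
  split; first by apply: nbhsx_ballx; lra.
  by apply: nbhs_pinfty_ge; rewrite num_real.
case=> x C [/= x0x leC] y.
have C0 : 0 <= C.
  apply: le_trans leC; rewrite /B.
  by apply: divr_ge0; rewrite ?sqr_ge0// mulrn_wge0// addr_ge0.
have q0 := sqdist_ge0 _ _ _ x y.
have [x0y|x0y] := pselect (ball x0 r y).
  have x0xr : ball x0 r x by apply: le_ball x0x; lra.
  have := rf _ x0y; have := rf _ x0xr => /= h1 h2.
  have : `|f y - f x| < e.
    rewrite (_ : f y - f x = (f x0 - f x) - (f x0 - f y)); last by ring.
    by apply: le_lt_trans (ler_normB _ _) _; lra.
  by have := mulr_ge0 C0 q0; lra.
have xy : r / 2 <= `|\val y - \val x : 'rV[R]_d|.
  rewrite leNgt; apply/negP => xy; apply: x0y.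
  rewrite [r]splitr; apply: (ball_triangle x0x).
  rewrite distrC in xy.
  rewrite -[ball x _ y]/(ball (\val x) (r / 2) (\val y)) -ball_normE.
  exact: xy.
apply: (@le_trans _ _ (B *+ 2)).
  apply: le_trans (ler_normB _ _) _.
  by rewrite mulr2n lerD.
apply: (@le_trans _ _ (C * sqdist x y)); last lra.
have h : (r / 2) ^+ 2 <= sqdist x y.
  apply: le_trans (sqr_norm_le_sqdist _ _ _ x y).
  by rewrite ler_sqr ?nnegrE//; lra.
have r2 : 0 < (r / 2) ^+ 2 by rewrite exprn_gt0//; lra.
rewrite ler_pdivrMr// in leC.
by apply: le_trans leC _; rewrite ler_wpM2l.
Qed.

(** Positivity is applied to [g - f] and to [g + f]. *)
Lemma positive_operator_norm_le (R : realType) (d : nat) (X : set 'rV[R]_d)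
    (E : submodClosed (X -> R)) (T : {linear submod_type E -> (X -> R)})
    (f g : submod_type E) :
  positive_operator T -> (forall y, `|\val f y| <= \val g y) ->
  forall x, `|T f x| <= T g x.
Proof.
move=> Tpos fg x.
have h1 : 0 <= T (g - f) x.
  apply: Tpos => y; have := fg y; rewrite ler_norml => /andP[_].
  by rewrite raddfB subr_ge0.
have h2 : 0 <= T (g + f) x.
  apply: Tpos => y; have := fg y; rewrite ler_norml => /andP[+ _].
  by rewrite raddfD -subr_ge0 opprK addrC.
move: h1 h2; rewrite raddfB raddfD => h1 h2.
rewrite ler_norml; apply/andP; split.
  by rewrite -subr_ge0 opprK addrC.
by rewrite -subr_ge0.
Qed.

(** Stated for all large [C], so that one constant can serve both here and in
    [quadratic_modulus]. *)
Lemma compact_norm_bounded (R : realType) (d : nat) (X : set 'rV[R]_d)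
    (K : set X) : compact K ->
  \forall C \near +oo, forall x, K x -> forall i, `|pr X i x| <= C.
Proof.
move=> cK.
have cval : continuous (\val : X -> 'rV[R]_d) by exact: initial_continuous.
have /compact_bounded : compact ((\val : X -> 'rV[R]_d) @` K).
  by apply: continuous_compact => //; exact: continuous_subspaceT.
case=> B [Breal hB]; exists B; split=> // C BC x Kx i.
apply: le_trans (hB C BC (\val x) _); last by exists x.
rewrite [leRHS]mx_normrE; apply: (le_bigmax _ _ (ord0, i)).
Qed.

Lemma linear_combination (R : realType) (U : Type) (V : lmodType R)
    (T : {linear V -> (U -> R)}) (a b : R) (u v : V) (x : U) :
  T (a *: u + b *: v) x = a * T u x + b * T v x.
Proof. by rewrite linearD !linearZ. Qed.

(* When [one], [s], [p] are the test functions this is [sqdist x] with the square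
   expanded; [V] is abstract so that [linear_quadratic] applies both to [\val] and
   to the operators. *)
Definition quadratic {R : realType} {d : nat} {X : set 'rV[R]_d} {V : lmodType R}
    (one s : V) (p : 'I_d -> V) (x : X) : V :=
  s - \sum_(i < d) (2 * pr X i x) *: p i + (sum_pr_sq X x) *: one.

Lemma linear_quadratic (R : realType) (d : nat) (X : set 'rV[R]_d)
    (V : lmodType R) (T : {linear V -> (X -> R)}) (one s : V) (p : 'I_d -> V)
    (x y : X) :
  T (quadratic one s p x) y =
  T s y - \sum_(i < d) 2 * pr X i x * T (p i) y + sum_pr_sq X x * T one y.
Proof.
rewrite /quadratic linearD linearB linear_sum linearZ/=.
rewrite -[LHS]/(T s y - (\sum_(i < d) T ((2 * pr X i x) *: p i)) y
  + sum_pr_sq X x * T one y).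
congr (_ - _ + _); rewrite fct_sumE; apply: eq_bigr => i _.
by rewrite linearZ.
Qed.

Theorem theorem4p1 (R : realType) (d : nat) (hd : (1 <= d)%N)
    (X : set 'rV[R]_d) (hX : locally_compact_subset X)
    (E : submodClosed (X -> R)) (hE : lattice_subspace E)
    (hT : test_functions X `<=` [set f | f \in E])
    (L : nat -> {linear submod_type E -> (X -> R)})
    (hpos : forall n : nat, positive_operator (L n))
    (hlim : forall g : submod_type E, test_functions X (\val g) ->
      {family compact, (fun n => L n g) @ \oo --> \val g}) :
  forall f : submod_type E, Cb X (\val f) ->
    {family compact, (fun n => L n f) @ \oo --> \val f}.
Proof.
move=> f fCb; apply/fam_cvgP => K cK; apply/uniform_cvgrPdist_lt => e e0.
have t1 : test_functions X (cst 1) by left; left.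
have tp i : test_functions X (pr X i) by left; right; exists i.
have ts : test_functions X (sum_pr_sq X) by right.
pose one := Submod (hT _ t1); pose s := Submod (hT _ ts).
pose p i := Submod (hT _ (tp i)).
have unif g : test_functions X (\val g) -> forall eta, 0 < eta ->
    \forall n \near \oo, forall x, K x -> `|\val g x - L n g x| < eta.
  by move=> /hlim /fam_cvgP /(_ _ cK) /uniform_cvgrPdist_lt.
have [M M0 fM] : exists2 M : R, 0 <= M & forall x, `|\val f x| <= M.
  case: (fCb) => _ [M [_ fM]]; exists (`|M| + 1) => [|x].
    by rewrite addr_ge0.
  by apply: fM => //; have := ler_norm M; lra.
have e4 : 0 < e / 4 by lra.
have [C [C0 KC fC]] : exists C : R, [/\ 0 < C,
    (forall x, K x -> forall i, `|pr X i x| <= C) &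
    forall x, K x -> forall y, `|\val f y - \val f x| <= e / 4 + C * sqdist x y].
  near (pinfty_nbhs R) => C; exists C; split; near: C.
  - exact: nbhs_pinfty_gt.
  - exact: compact_norm_bounded.
  - exact: quadratic_modulus.
(* [A] bounds the sum of the absolute values of the coefficients of [quadratic one s p x], for [x]
   in [K]. *)
pose A := 1 + \sum_(i < d) 2 * C + \sum_(i < d) C ^+ 2.
have A0 : 0 <= A.
  by rewrite /A !addr_ge0 ?sumr_ge0// => i _; rewrite ?sqr_ge0//; lra.
pose D := C * A + M.
have D0 : 0 <= D by rewrite /D addr_ge0// mulr_ge0// ltW.
(* The bound 1 keeps [L n one x] below 2; [D + 1] avoids dividing by zero. *)
pose eta := Num.min 1 (e / 4 / (D + 1)).
have D1 : 0 < D + 1 by lra.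
have eta0 : 0 < eta by rewrite lt_min ltr01/= divr_gt0.
have eta1 : eta <= 1 by rewrite ge_min lexx.
have etaD : D * eta <= e / 4.
  apply: (@le_trans _ _ ((D + 1) * eta)).
    by rewrite ler_wpM2r ?ltW//; lra.
  by rewrite -ler_pdivlMl// mulrC ge_min lexx orbT.
have u1 := unif one t1 _ eta0; have us := unif s ts _ eta0.
have up : \forall n \near \oo, forall i x, K x -> `|pr X i x - L n (p i) x| < eta.
  by apply: filter_forall => i; exact: (unif (p i) (tp i) _ eta0).
apply: filterS3 u1 us up => n n1 ns np x Kx.
have {n1} n1 : `|1 - L n one x| < eta := n1 x Kx.
have {ns} ns : `|sum_pr_sq X x - L n s x| < eta := ns x Kx.
have {np} np i : `|pr X i x - L n (p i) x| < eta := np i x Kx.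
pose q := quadratic one s p x.
have qE y : \val q y = sqdist x y.
  rewrite (linear_quadratic _ _ _ _ (\val : {linear submod_type E -> (X -> R)})).
  rewrite -[LHS]/(sum_pr_sq X y - \sum_(i < d) 2 * pr X i x * pr X i y
    + sum_pr_sq X x * 1).
  rewrite mulr1 -sumrN -!big_split/=.
  by apply: eq_bigr => i _; rewrite /=; ring.
have Lq : L n q x <= eta * A.
  rewrite linear_quadratic.
  (* Only the errors on the test functions remain, since the quadratic vanishes at its centre: its
     exact values there cancel. *)
  rewrite (_ : _ + _ = (L n s x - sum_pr_sq X x)
      + \sum_(i < d) (2 * pr X i x) * (pr X i x - L n (p i) x)
      + sum_pr_sq X x * (L n one x - 1)); last first.
    under [in RHS]eq_bigr do rewrite mulrBr.
    rewrite sumrB.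
    have -> : \sum_(i < d) 2 * pr X i x * pr X i x = 2 * sum_pr_sq X x.
      by rewrite mulr_sumr; apply: eq_bigr => i _; ring.
    by ring.
  rewrite /A ![eta * _]mulrDr mulr1; apply: lerD; first apply: lerD.
  - by apply: ltW; apply: le_lt_trans (ler_norm _) _; rewrite distrC.
  - rewrite mulr_sumr; apply: ler_sum => i _.
    apply: le_trans (ler_norm _) _.
    rewrite normrM mulrC; apply: ler_pM => //; first exact/ltW/np.
    by rewrite normrM [`|2|]ger0_norm// ler_pM2l//; exact: KC.
  - apply: le_trans (ler_norm _) _.
    rewrite normrM mulrC; apply: ler_pM => //; first by rewrite distrC ltW.
    rewrite ger0_norm; last by apply: sumr_ge0 => i _; exact: sqr_ge0.
    apply: ler_sum => i _; rewrite -real_normK ?num_real// ler_sqr ?nnegrE//.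
      exact: KC.
    exact: ltW.
have main : `|L n f x - \val f x * L n one x| <= e / 4 * L n one x + C * L n q x.
  (* With [x] frozen, both sides become values of [L n] at elements of [E], so a pointwise
     comparison of these elements suffices. *)
  rewrite -linear_combination -[L n f x]mul1r -mulNr -linear_combination.
  apply: positive_operator_norm_le => // y.
  pose T := \val : {linear submod_type E -> (X -> R)}.
  have valE := linear_combination _ _ _ T.
  have T1 : T one y = 1 by [].
  have Tq : T q y = sqdist x y := qE y.
  rewrite (valE 1) (valE (e / 4)) T1 Tq !mulr1 mul1r.
  exact: fC.
have Cq : C * L n q x <= C * (eta * A) by rewrite ler_pM2l.
have fx1 : `|\val f x * (1 - L n one x)| <= M * eta.
  by rewrite normrM ler_pM// ltW.
have L1 : e / 4 * L n one x <= e / 4 * 2.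
  rewrite ler_pM2l//; move: n1; rewrite distrC ltr_norml => /andP[_]; lra.
(* The errors add up to at most [M * eta + e / 4 * 2 + C * (eta * A)], hence to at most three
   quarters of [e]. *)
rewrite (_ : _ - _ = \val f x * (1 - L n one x) - (L n f x - \val f x * L n one x));
  last by ring.
apply: le_lt_trans (ler_normB _ _) _.
have : D * eta = C * (eta * A) + M * eta by rewrite /D; ring.
lra.
Unshelve. all: end_near.
Qed.
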